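(* Let $H$ be an ordered abelian group, $D$ its divisible ordered closure, and $R_{=0},R_{\ge0},R_{>0}$ three finite families of elements of $H\{x\}=H\{x_1,\dots,x_n\}$. Let $\mathcal H_{=0}$ be the subgroup of $H\{x\}$ generated by $R_{=0}$, and $\mathcal P_{\ge0}$ the additive monoid in $H\{x\}$ generated by $R_{\ge0}\cup R_{>0}\cup H^{>0}$. The system of sign conditions $[\,u(x)>0,\ q(x)\ge0,\ j(x)=0\,]$ for $u\in R_{>0}$, $q\in R_{\ge0}$, $j\in R_{=0}$ is impossible in $D^n$ if and only if there is an equality in $H\{x\}$ $$s+q+i=0$$ with $s\in R_{>0}\cup H^{>0}$, $q\in\mathcal P_{\ge0}$ and $i\in\mathcal H_{=0}$.
   Context: Ordered groups are abelian, written additively, and totally ordered compatibly with the group law; $H^{>0}$ is the set of positive elements of $H$. The divisible ordered closure of $H$ is its divisible hull $H\otimes_{\mathbb Z}\mathbb Q$ with the unique total group order extending that of $H$. $H\{x_1,\dots,x_n\}$ denotes the abelian group of affine forms $h+\sum_k a_kx_k$ with $h\in H$ and $a_k\in\mathbb Z$ (the abelian group generated by $H$ and the variables $x_1,\dots,x_n$); such a form is evaluated at points of $D^n$ in the obvious way. Additive monoids contain $0$.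
   Formalization: The formal theorem assumes that H is not the trivial group; for H = 0 and n = 1 the system x_1 > 0 is impossible in D = 0, yet no equality s + q + i = 0 of the required form exists. *)

(* Defs.v *)
From HB Require Import structures.
From mathcomp Require Import all_boot all_order all_algebra generic_quotient.

Set Implicit Arguments.
Unset Strict Implicit.
Unset Printing Implicit Defensive.

Import Order.TTheory GRing.Theory Num.Theory.
Local Open Scope ring_scope.

(* MathComp has no structure between porderZmodType, which does not relate the
   order to the addition, and numDomainType, which is a ring.  Totality is a
   field here, because HB rejects a join of Order.Total and GRing.Zmodule that
   is declared after Num.RealDomain. *)
HB.mixin Record isOrderedZmodule H of Num.POrderedZmodule H := {
  oz_le_total : total (<=%R : rel H);
  oz_lerD2l : forall z x y : H, x <= y -> z + x <= z + y
}.

#[short(type="orderedZmodType")]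
HB.structure Definition OrderedZmodule :=
  { H of Num.POrderedZmodule H & isOrderedZmodule H }.

(* D, with the embedding iota, is the divisible hull of H carrying a total
   group order that extends the one of H.  As D is torsion-free, the last two
   fields say that D is a rational vector space whose elements all have the
   form (iota h) / m: up to a unique isomorphism over H, D is H (x) Q.
   Existence is divisible_closure_exists, uniqueness divisible_closure_unique. *)
Record is_divisible_ordered_closure (H D : orderedZmodType)
    (iota : {additive H -> D}) : Prop := IsDivisibleOrderedClosure {
  closure_mono : {mono iota : h k / h <= k};
  closure_divisible : forall (d : D) (m : nat), (0 < m)%N ->
    exists e : D, e *+ m = d;
  closure_torsion : forall d : D, exists2 m : nat, (0 < m)%N &
    exists h : H, d *+ m = iota h
}.

(* The pair (h, a) is the affine form h + \sum_k a_k x_k. *)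
Definition affine_form (H : zmodType) (n : nat) : zmodType :=
  (H * 'rV[int]_n)%type.

Definition affine_const (H : zmodType) (n : nat) (h : H) : affine_form H n :=
  (h, 0).

Definition affine_eval (H D : zmodType) (iota : {additive H -> D}) (n : nat)
    (f : affine_form H n) (x : 'rV[D]_n) : D :=
  iota f.1 + \sum_(k < n) x ord0 k *~ f.2 ord0 k.

Definition positive_const (H : orderedZmodType) (n : nat)
    (f : affine_form H n) : Prop :=
  exists2 h : H, 0 < h & f = affine_const n h.

Inductive generated_submonoid (V : nmodType) (S : V -> Prop) : V -> Prop :=
| gen_monoid_mem f : S f -> generated_submonoid S f
| gen_monoid0 : generated_submonoid S 0
| gen_monoidD f g : generated_submonoid S f -> generated_submonoid S g ->
    generated_submonoid S (f + g).

Inductive generated_subgroup (V : zmodType) (S : V -> Prop) : V -> Prop :=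
| gen_group_mem f : S f -> generated_subgroup S f
| gen_group0 : generated_subgroup S 0
| gen_groupD f g : generated_subgroup S f -> generated_subgroup S g ->
    generated_subgroup S (f + g)
| gen_groupN f : generated_subgroup S f -> generated_subgroup S (- f).

Section OrderedZmoduleTheory.
Variable H : orderedZmodType.
Implicit Types x y z t : H.

Lemma oz_ltNge x y : (x < y) = ~~ (y <= x).
Proof. exact/comparable_ltNge/oz_le_total. Qed.

Lemma oz_lerD x y z t : x <= y -> z <= t -> x + z <= y + t.
Proof.
move=> xy zt; apply: (le_trans (oz_lerD2l x _ _ zt)).
by rewrite ![_ + t]addrC; apply: oz_lerD2l.
Qed.

Lemma oz_ltrD x y z t : x < y -> z <= t -> x + z < y + t.
Proof.
move=> xy zt; rewrite lt_neqAle (oz_lerD (ltW xy) zt) andbT.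
apply/eqP => e; move: xy; rewrite oz_ltNge => /negP; apply.
have := oz_lerD2l (- z) _ _ (oz_lerD2l y _ _ zt).
by rewrite -e !(addrC (- z)) !addrK.
Qed.

Lemma oz_lerMn2r x y m : (0 < m)%N -> (x *+ m <= y *+ m) = (x <= y).
Proof.
case: m => // m _; apply/idP/idP; last first.
  by move=> xy; elim: m => // m IH; rewrite !(mulrS _ m.+1) oz_lerD.
apply: contraLR; rewrite -!oz_ltNge => yx.
elim: m => // m IH; rewrite !(mulrS _ m.+1); apply: oz_ltrD => //; exact: ltW.
Qed.

Lemma oz_mulrnI m : (0 < m)%N -> injective (fun x => x *+ m).
Proof.
by move=> m0 x y /= e; apply/eqP; rewrite eq_le -(oz_lerMn2r x y m0) -(oz_lerMn2r y x m0) e lexx.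
Qed.

End OrderedZmoduleTheory.

(* The pair (h, m) stands for the fraction h / (m + 1). *)
Module DivisibleClosure.
Section Construction.
Variable H : orderedZmodType.
Implicit Types (h k : H) (u v w : H * nat).

Definition equiv u v := u.1 *+ v.2.+1 == v.1 *+ u.2.+1.

Lemma equiv_refl : reflexive equiv.
Proof. by move=> u; apply/eqP. Qed.

Lemma equiv_sym : symmetric equiv.
Proof. by move=> u v; rewrite /equiv eq_sym. Qed.

Lemma equiv_trans : transitive equiv.
Proof.
move=> v u w /eqP uv /eqP vw; apply/eqP/(@oz_mulrnI _ v.2.+1) => //=.
by rewrite mulrnAC uv mulrnAC vw mulrnAC.
Qed.

Canonical equiv_rel := EquivRel equiv equiv_refl equiv_sym equiv_trans.

Definition type := {eq_quot equiv}%qT.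
HB.instance Definition _ := Choice.on type.

Definition frac h m : type := (\pi_type (h, m))%qT.
Definition num (a : type) : H := (repr a).1.
Definition den (a : type) : nat := (repr a).2.

Lemma fracE a : frac (num a) (den a) = a.
Proof. by rewrite /frac /num /den -surjective_pairing reprK. Qed.

Lemma fracP h m k p : frac h m = frac k p <-> h *+ p.+1 = k *+ m.+1.
Proof. by split=> [/eqmodP/eqP | e]; last apply/eqmodP/eqP. Qed.

Lemma numdenP h m : num (frac h m) *+ m.+1 = h *+ (den (frac h m)).+1.
Proof. exact/fracP/fracE. Qed.

Definition zero := frac 0 0.
Definition opp a := frac (- num a) (den a).
Definition add a b := frac (num a *+ (den b).+1 + num b *+ (den a).+1)
  ((den a).+1 * (den b).+1).-1.
Definition le a b := num a *+ (den b).+1 <= num b *+ (den a).+1.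
Definition lt a b := (b != a) && le a b.

Lemma fracN h m : opp (frac h m) = frac (- h) m.
Proof. by apply/fracP; rewrite !mulNrn numdenP. Qed.

Lemma num_cross h m b p :
  num (frac h m) *+ (b * (m.+1 * p)) = h *+ (p * ((den (frac h m)).+1 * b)).
Proof. by rewrite mulnCA mulrnA numdenP -mulrnA mulnA mulnC. Qed.

Lemma fracD h m k p :
  add (frac h m) (frac k p) = frac (h *+ p.+1 + k *+ m.+1) (m.+1 * p.+1).-1.
Proof.
apply/fracP; rewrite !prednK // !mulrnDl -!mulrnA num_cross.
by rewrite (mulnC m.+1 p.+1) num_cross (mulnC (den (frac k p)).+1).
Qed.

Lemma fracle h m k p : le (frac h m) (frac k p) = (h *+ p.+1 <= k *+ m.+1).
Proof.
rewrite /le; set a := den (frac h m); set b := den (frac k p).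
rewrite -(@oz_lerMn2r _ _ _ (m.+1 * p.+1)) // -!mulrnA num_cross -/a.
rewrite (mulnC m.+1 p.+1) num_cross -/b (mulnC b.+1).
by rewrite !mulrnA !oz_lerMn2r.
Qed.

Lemma ind (P : type -> Prop) : (forall h m, P (frac h m)) -> forall a, P a.
Proof. by move=> Pf a; rewrite -(fracE a). Qed.

Lemma addA : associative add.
Proof.
elim/ind=> h m; elim/ind=> k p; elim/ind=> l q; rewrite !fracD !prednK //.
apply/fracP; congr (_ *+ _); last by rewrite !prednK // mulnA.
by rewrite !mulrnDl -!mulrnA addrA (mulnC q.+1 m.+1) (mulnC p.+1 m.+1).
Qed.

Lemma addC : commutative add.
Proof. by elim/ind=> h m; elim/ind=> k p; rewrite !fracD addrC mulnC. Qed.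

Lemma add0 : left_id zero add.
Proof. by elim/ind=> h m; rewrite fracD mul0rn add0r mul1n. Qed.

Lemma addN : left_inverse zero opp add.
Proof.
elim/ind=> h m; rewrite fracN fracD mulNrn addNr.
by apply/fracP; rewrite !mul0rn.
Qed.

HB.instance Definition _ := GRing.isZmodule.Build type addA addC add0 addN.

Lemma le_anti : antisymmetric le.
Proof.
elim/ind=> h m; elim/ind=> k p; rewrite !fracle => /le_anti e; exact/fracP.
Qed.

Lemma le_trans : transitive le.
Proof.
elim/ind=> k p; elim/ind=> h m; elim/ind=> l q; rewrite !fracle.
rewrite -(@oz_lerMn2r _ _ _ q.+1) // -(@oz_lerMn2r _ (k *+ _) _ m.+1) //.
rewrite (mulrnAC k q.+1) => hk /(Order.POrderTheory.le_trans hk).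
by rewrite (mulrnAC h) (mulrnAC l) oz_lerMn2r.
Qed.

Lemma le_total : total le.
Proof. by elim/ind=> h m; elim/ind=> k p; rewrite !fracle oz_le_total. Qed.

Lemma le_refl : reflexive le.
Proof. by move=> a; have := le_total a a; rewrite orbb. Qed.

HB.instance Definition _ := Order.isPOrder.Build ring_display type
  (fun _ _ => erefl : lt _ _ = _) le_refl le_anti le_trans.

Lemma le_add2l (c a b : type) : a <= b -> c + a <= c + b.
Proof.
change (le a b -> le (add c a) (add c b)).
elim/ind: a => h m; elim/ind: b => k p; elim/ind: c => l q.
rewrite !fracD !fracle !prednK // => hk.
rewrite !mulrnDl -!mulrnA (mulnCA m.+1) (mulnCA p.+1) (mulnC m.+1).
apply: oz_lerD2l.
by rewrite !mulnA !(mulnC (q.+1 * q.+1)) !mulrnA !oz_lerMn2r.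
Qed.

HB.instance Definition _ := isOrderedZmodule.Build type le_total le_add2l.

Definition embed h := frac h 0.

Lemma embed_is_additive : nmod_morphism embed.
Proof.
split=> // h k; change (embed (h + k) = add (embed h) (embed k)).
by rewrite fracD.
Qed.

HB.instance Definition _ := GRing.isNmodMorphism.Build H type embed
  embed_is_additive.

Lemma fracMn h m p : frac h m *+ p = frac (h *+ p) m.
Proof.
elim: p => [|p IH]; first by rewrite !mulr0n; apply/fracP; rewrite !mul0rn.
rewrite mulrS IH; change (add (frac h m) (frac (h *+ p) m) = frac (h *+ p.+1) m).
by rewrite fracD; apply/fracP; rewrite prednK // -mulrnDl -mulrS mulrnA.
Qed.

Lemma embed_closure :
  is_divisible_ordered_closure (embed : {additive H -> type}).
Proof.
split=> [h k|a [//|m] _|a]; first exact: fracle.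
  exists (frac (num a) ((den a).+1 * m.+1).-1); rewrite fracMn -[RHS]fracE.
  by apply/fracP; rewrite prednK // -mulrnA mulnC.
exists (den a).+1 => //; exists (num a); rewrite -{1}(fracE a) fracMn.
exact/fracP.
Qed.

End Construction.
End DivisibleClosure.

Lemma divisible_closure_exists (H : orderedZmodType) :
  exists (D : orderedZmodType) (iota : {additive H -> D}),
    is_divisible_ordered_closure iota.
Proof. exact: (ex_intro _ _ (ex_intro _ _ (@DivisibleClosure.embed_closure H))). Qed.

Definition same_fraction (H D E : orderedZmodType) (iota : {additive H -> D})
    (jota : {additive H -> E}) (d : D) (e : E) : Prop :=
  exists2 m : nat, (0 < m)%N & exists2 h : H, d *+ m = iota h & e *+ m = jota h.

Section SameFraction.
Variables (H D E : orderedZmodType).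
Variables (iota : {additive H -> D}) (jota : {additive H -> E}).
Hypothesis closD : is_divisible_ordered_closure iota.
Hypothesis closE : is_divisible_ordered_closure jota.

Lemma same_fraction_le d e d' e' :
  same_fraction iota jota d e -> same_fraction iota jota d' e' ->
  (e <= e') = (d <= d').
Proof.
move=> [m m0 [h dh eh]] [p p0 [k dk ek]].
have mp0 : (0 < m * p)%N by rewrite muln_gt0 m0.
rewrite -(oz_lerMn2r e e' mp0) -(oz_lerMn2r d d' mp0).
rewrite !(mulrnA _ m) eh dh !(mulrnAC _ m) ek dk -!raddfMn.
by rewrite (closure_mono closD) (closure_mono closE).
Qed.

Lemma same_fraction_inj d e e' :
  same_fraction iota jota d e -> same_fraction iota jota d e' -> e = e'.
Proof.
move=> de de'; apply/eqP; rewrite eq_le.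
by rewrite (same_fraction_le de de') (same_fraction_le de' de) lexx.
Qed.

Lemma same_fractionD d e d' e' :
  same_fraction iota jota d e -> same_fraction iota jota d' e' ->
  same_fraction iota jota (d + d') (e + e').
Proof.
move=> [m m0 [h dh eh]] [p p0 [k dk ek]].
exists (m * p)%N; first by rewrite muln_gt0 m0.
exists (h *+ p + k *+ m); rewrite mulrnDl raddfD !raddfMn /=.
  by rewrite mulrnA dh mulnC mulrnA dk.
by rewrite mulrnA eh mulnC mulrnA ek.
Qed.

Lemma same_fraction_fun :
  exists f : D -> E, forall d, same_fraction iota jota d (f d).
Proof.
have exh d : exists p : nat * H, (0 < p.1)%N && (d *+ p.1 == iota p.2).
  have [m m0 [h dh]] := closure_torsion closD d.
  by exists (m, h); rewrite m0 dh /=.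
pose p d := xchoose (exh d).
have exe d : exists e : E, e *+ (p d).1 == jota (p d).2.
  have /andP[m0 _] := xchooseP (exh d).
  have [e eh] := closure_divisible closE (jota (p d).2) m0.
  by exists e; rewrite eh.
exists (fun d => xchoose (exe d)) => d.
have /andP[m0 /eqP dh] := xchooseP (exh d).
by exists (p d).1 => //; exists (p d).2 => //; apply/eqP/(xchooseP (exe d)).
Qed.

End SameFraction.

Lemma divisible_closure_unique (H D E : orderedZmodType)
    (iota : {additive H -> D}) (jota : {additive H -> E}) :
  is_divisible_ordered_closure iota -> is_divisible_ordered_closure jota ->
  exists f : D -> E,
    [/\ {morph f : c d / c + d}, {mono f : c d / c <= d}, bijective f,
        forall h, f (iota h) = jota h
      & forall g : {additive D -> E},
          (forall h, g (iota h) = jota h) -> g =1 f].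
Proof.
move=> cD cE; have [f fP] := same_fraction_fun cD cE.
have [g gP] := same_fraction_fun cE cD.
have sym d e : same_fraction iota jota d e -> same_fraction jota iota e d.
  by move=> [m m0 [h dh eh]]; exists m => //; exists h.
have sym' d e : same_fraction jota iota e d -> same_fraction iota jota d e.
  by move=> [m m0 [h dh eh]]; exists m => //; exists h.
exists f; split.
- move=> c d; apply: (same_fraction_inj cD cE (fP _)).
  exact: same_fractionD.
- by move=> c d; apply: (same_fraction_le cD cE).
- exists g => [d|e].
    by apply: (same_fraction_inj cE cD (gP _)); apply: sym.
  by apply: (same_fraction_inj cD cE (fP _)); apply: sym'.
- move=> h; apply: (same_fraction_inj cD cE (fP _)).
  by exists 1%N => //; exists h; rewrite mulr1n.
- move=> k kP d; apply: (same_fraction_inj cD cE _ (fP d)).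
  have [m m0 [h dh]] := closure_torsion cD d.
  by exists m => //; exists h; rewrite // -raddfMn dh kP.
Qed.

(* Main.v *)
Require Import Defs.
From mathcomp Require Import all_boot all_order all_algebra.

Import Order.TTheory GRing.Theory Num.Theory.
Local Open Scope ring_scope.

(** An identity s + q + i = 0 is an obstruction, because at a solution x its
    left-hand side would take a positive value.

    The converse is Fourier-Motzkin elimination, carried out with integer
    multipliers.  Replace each equation j = 0 by the two inequalities j >= 0
    and - j >= 0, so that only strict and weak inequalities remain.  To
    eliminate x_k, keep the inequalities without x_k, and add to each
    inequality p with a positive coefficient a of x_k each inequality q with a
    negative coefficient - b, in the combination b p + a q, where x_k cancels.
    At a point satisfying the new system, p bounds x_k from below by
    - p / a and q bounds it from above by q / b (both evaluated at x_k = 0),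
    and b p + a q says that the two bounds are compatible.  The divisibility
    of D makes these quotients available; as D is moreover nontrivial, its
    order is dense without endpoints, so a value of x_k fits between finitely
    many compatible bounds (separation).  Hence elimination preserves
    unsatisfiability (eliminate_satisfiable).

    Once all variables are gone, an unsatisfiable system contains a false
    inequality between constants: h > 0 with h <= 0, or h >= 0 with h < 0
    (fourier_motzkin).  The constant h is a sum of the original forms, which
    sorts into a strict term s if the inequality is strict, a part q in the
    monoid and a part i in the group (consequence_decomposition).  If h < 0,
    the positive constant - h brings the sum to zero: it joins q, or serves as
    s when there is no strict term (contradiction_certificate). *)

Set Implicit Arguments.
Unset Strict Implicit.
Unset Printing Implicit Defensive.

(** * Ordered abelian groups *)

Section OrderedZmodule.
Variable H : orderedZmodType.
Implicit Types (x y z t : H) (C : bool).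

Lemma oz_lerD2lE z x y : (z + x <= z + y) = (x <= y).
Proof.
apply/idP/idP; last exact: oz_lerD2l.
by move/(oz_lerD2l (- z)); rewrite !addKr.
Qed.

Lemma oz_ltrD2lE z x y : (z + x < z + y) = (x < y).
Proof. by rewrite !oz_ltNge oz_lerD2lE. Qed.

Lemma oz_lteifD2l C z x y : (z + x < z + y ?<= if C) = (x < y ?<= if C).
Proof. by case: C; rewrite /= ?oz_ltrD2lE ?oz_lerD2lE. Qed.

Lemma oz_lteif0D C x y : (0 < x + y ?<= if C) = (- x < y ?<= if C).
Proof. by rewrite -(oz_lteifD2l C x (- x)) subrr. Qed.

Lemma oz_ltrMn2r m x y : (0 < m)%N -> (x *+ m < y *+ m) = (x < y).
Proof. by move=> m0; rewrite !oz_ltNge oz_lerMn2r. Qed.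

Lemma oz_lteifMn2r C m x y : (0 < m)%N ->
  (x *+ m < y *+ m ?<= if C) = (x < y ?<= if C).
Proof. by move=> m0; case: C; rewrite /= ?oz_ltrMn2r ?oz_lerMn2r. Qed.

Lemma oz_oppr_gt0 x : (0 < - x) = (x < 0).
Proof. by rewrite -(oz_ltrD2lE x 0) addr0 subrr. Qed.

Lemma oz_oppr_ge0 x : (0 <= - x) = (x <= 0).
Proof. by rewrite -(oz_lerD2lE x 0) addr0 subrr. Qed.

Lemma oz_gt0_exists : (exists h : H, h != 0) -> exists h : H, 0 < h.
Proof.
case=> h h0; have [h_gt0|h_le0] := boolP (0 < h); first by exists h.
by exists (- h); rewrite oz_oppr_gt0 lt_neqAle h0 -[h <= 0]negbK -oz_ltNge.
Qed.

Lemma oz_lteifN C x y : (- x < - y ?<= if C) = (y < x ?<= if C).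
Proof. by rewrite -oz_lteif0D addrC oz_lteif0D opprK. Qed.

Lemma oz_lteifNE C x y : (x < y ?<= if ~~ C) = ~~ (y < x ?<= if C).
Proof. by case: C; rewrite /= oz_ltNge ?negbK. Qed.

End OrderedZmodule.

(** * Finitely many bounds on one variable *)

(** A bound is a pair (w, d), and w tells whether it is weak, so that the
    inequalities are instances of [x < y ?<= if w]: chaining two of them, or
    adding them, gives a weak inequality only if both are weak. *)
Section Separation.
Variable D : orderedZmodType.
Implicit Types (A B : seq (bool * D)) (l u : bool * D) (t d e : D).

Lemma lower_bound_le l l' t : l.2 < l'.2 ?<= if l'.1 ==> l.1 ->
  l'.2 < t ?<= if l'.1 -> l.2 < t ?<= if l.1.
Proof.
move=> ll' l't; apply: lteif_imply (lteif_trans ll' l't).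
by case: (l.1); case: (l'.1).
Qed.

(** A largest bound wins, and a strict one wins among equal values; the flag
    l.1 ==> l0.1 in the proof expresses this tie-breaking rule. *)
Lemma tightest_lower_bound l0 A : exists2 l, l \in l0 :: A &
  forall t, l.2 < t ?<= if l.1 ->
    forall l', l' \in l0 :: A -> l'.2 < t ?<= if l'.1.
Proof.
elim: A l0 => [|l1 A IH] l0.
  by exists l0; rewrite ?mem_head // => t lt l'; rewrite inE => /eqP->.
have [l lA lP] := IH l1.
have [le_l0l|] := boolP (l0.2 < l.2 ?<= if l.1 ==> l0.1).
  exists l; first by rewrite inE lA orbT.
  move=> t lt l'; rewrite inE => /predU1P[->|/lP]; last exact.
  exact: lower_bound_le lt.
rewrite -oz_lteifNE => le_ll0; exists l0; first exact: mem_head.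
move=> t l0t l'; rewrite inE => /predU1P[->//|]; apply: lP.
apply: lower_bound_le l0t; apply: lteif_imply le_ll0.
by case: (l.1); case: (l0.1).
Qed.

Lemma tightest_upper_bound u0 B : exists2 u, u \in u0 :: B &
  forall t, t < u.2 ?<= if u.1 ->
    forall u', u' \in u0 :: B -> t < u'.2 ?<= if u'.1.
Proof.
pose opp u := (u.1, - u.2).
have oppK : cancel opp opp by case=> b d; rewrite /opp opprK.
have [l lB lP] := tightest_lower_bound (opp u0) (map opp B).
exists (opp l) => [|t tu u' u'B].
  by rewrite -(mem_map (can_inj oppK)) oppK.
rewrite -oz_lteifN; apply: (lP (- t) _ (opp u')).
  by rewrite -oz_lteifN opprK.
by rewrite -map_cons map_f.
Qed.

Hypothesis divD : forall (d : D) (m : nat), (0 < m)%N -> exists e, e *+ m = d.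
Hypothesis ntD : exists e : D, 0 < e.

(** The midpoint works if l.2 < u.2; otherwise both bounds are weak and
    equal. *)
Lemma between_bounds l u : l.2 < u.2 ?<= if l.1 && u.1 ->
  exists t, l.2 < t ?<= if l.1 /\ t < u.2 ?<= if u.1.
Proof.
move=> lu; have [lt_lu|] := boolP (l.2 < u.2).
  have [t t2] := divD (l.2 + u.2) (ltn0Sn 1).
  exists t; split; apply: lteifS; rewrite -(oz_ltrMn2r _ _ (ltn0Sn 1)) t2.
    by rewrite mulr2n oz_ltrD2lE.
  by rewrite mulr2n addrC oz_ltrD2lE.
move: lu; case: (l.1) (u.1) => [] [] /= lu; rewrite ?lu // => _.
by exists l.2; rewrite lexx.
Qed.

(** Pairwise compatibility suffices, as it applies to the tightest lower and
    upper bounds.  Without bounds on one side, a point beyond the tightest bound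
    of the other side exists because D has a positive element. *)
Lemma separation A B :
  (forall l u, l \in A -> u \in B -> l.2 < u.2 ?<= if l.1 && u.1) ->
  exists t, (forall l, l \in A -> l.2 < t ?<= if l.1) /\
            (forall u, u \in B -> t < u.2 ?<= if u.1).
Proof.
have [e e0] := ntD.
have lt_e d : d < d + e by rewrite -[ltLHS]addr0 oz_ltrD2lE.
case: A => [|l0 A]; case: B => [|u0 B] lu.
- by exists 0.
- have [u _ uP] := tightest_upper_bound u0 B.
  exists (u.2 - e); split=> // u'; apply: uP; apply: lteifS.
  by rewrite -[ltRHS](subrK e).
- have [l _ lP] := tightest_lower_bound l0 A.
  by exists (l.2 + e); split=> // l'; apply: lP; apply: lteifS.
- have [l lA lP] := tightest_lower_bound l0 A.
  have [u uB uP] := tightest_upper_bound u0 B.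
  have [t [lt tu]] := between_bounds (lu _ _ lA uB).
  by exists t; split=> [l'|u']; [exact: lP | exact: uP].
Qed.

End Separation.

(** * Evaluation and coefficients of affine forms *)

Section AffineForm.
Variables (H D : orderedZmodType) (iota : {additive H -> D}) (n : nat).
Implicit Types (f g : affine_form H n) (x : 'rV[D]_n) (j k : 'I_n) (m : nat).

Lemma affine_evalD f g x :
  affine_eval iota (f + g) x = affine_eval iota f x + affine_eval iota g x.
Proof.
rewrite /affine_eval raddfD /= addrACA -big_split; congr (_ + _).
by apply: eq_bigr => k _; rewrite mxE mulrzDr.
Qed.

Lemma affine_eval0 x : affine_eval iota 0 x = 0.
Proof. by apply: (addrI (affine_eval iota 0 x)); rewrite -affine_evalD !addr0. Qed.

Lemma affine_evalN f x : affine_eval iota (- f) x = - affine_eval iota f x.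
Proof.
by apply: (addrI (affine_eval iota f x)); rewrite -affine_evalD !subrr affine_eval0.
Qed.

Lemma affine_evalMn f m x :
  affine_eval iota (f *+ m) x = affine_eval iota f x *+ m.
Proof.
by elim: m => [|m IH]; rewrite ?mulr0n ?affine_eval0 // !mulrS affine_evalD IH.
Qed.

Lemma affine_eval_const h x : affine_eval iota (affine_const n h) x = iota h.
Proof. by rewrite /affine_eval big1 ?addr0 // => k _; rewrite mxE mulr0z. Qed.

Definition coefficient j f : int := f.2 ord0 j.

Lemma coefficientD j f g : coefficient j (f + g) = coefficient j f + coefficient j g.
Proof. by rewrite /coefficient mxE. Qed.

Lemma coefficientMn j f m : coefficient j (f *+ m) = coefficient j f *+ m.
Proof.
elim: m => [|m IH]; first by rewrite !mulr0n /coefficient mxE.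
by rewrite !mulrS coefficientD IH.
Qed.

Lemma coefficient0P f : (forall j, coefficient j f = 0) -> f = affine_const n f.1.
Proof.
case: f => h a a0; congr (_, _); apply/rowP => j; rewrite mxE; exact: (a0 j).
Qed.

Lemma affine_eval_shift f k t x :
  affine_eval iota f (\row_j (x ord0 j + t *+ (j == k))) =
  affine_eval iota f x + t *~ coefficient k f.
Proof.
rewrite /affine_eval -addrA; congr (_ + _).
under eq_bigr => j _ do rewrite mxE mulrzDl.
rewrite big_split /=; congr (_ + _).
rewrite (bigD1 k) //= eqxx mulr1n big1 ?addr0 // => j /negPf->.
by rewrite mulr0n mul0rz.
Qed.

End AffineForm.

(** * Fourier-Motzkin elimination *)

(** A constraint (w, f) is the inequality f >= 0 if w holds, and f > 0 if not.
    Eliminating a variable leaves the dimension n unchanged and only makes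
    coefficients vanish. *)
Section FourierMotzkin.
Variables (H D : orderedZmodType) (iota : {additive H -> D}) (n : nat).
Implicit Types (L : seq (bool * affine_form H n)) (c d : bool * affine_form H n).
Implicit Types (f g : affine_form H n) (x : 'rV[D]_n) (j k : 'I_n) (w : bool).

Definition satisfies x c := 0 < affine_eval iota c.2 x ?<= if c.1.

(** Sums are the only inference rule: multipliers are positive integers, so
    they are iterated sums. *)
Inductive consequence L : bool -> affine_form H n -> Prop :=
| conseq_mem c : c \in L -> consequence L c.1 c.2
| conseq_add w f w' f' : consequence L w f -> consequence L w' f' ->
    consequence L (w && w') (f + f').

Lemma consequenceMn L w f m : (0 < m)%N ->
  consequence L w f -> consequence L w (f *+ m).
Proof.
case: m => // m _ Lf; elim: m => // m IH; rewrite mulrS -(andbb w).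
exact: conseq_add.
Qed.

Lemma consequence_trans L L' w f :
  (forall c, c \in L' -> consequence L c.1 c.2) ->
  consequence L' w f -> consequence L w f.
Proof.
move=> LL'; elim=> [c /LL' //|{}w {}f w' f' _ Lf _ Lf']; exact: conseq_add.
Qed.

Definition cancel_coefficient k c d : bool * affine_form H n :=
  (c.1 && d.1,
   c.2 *+ `|coefficient k d.2|%N + d.2 *+ `|coefficient k c.2|%N).

Definition eliminate k L :=
  [seq c <- L | coefficient k c.2 == 0] ++
  [seq cancel_coefficient k c d | c <- [seq c <- L | 0 < coefficient k c.2],
                                  d <- [seq d <- L | coefficient k d.2 < 0]].

Lemma eliminateP k L c : c \in eliminate k L ->
  (c \in L /\ coefficient k c.2 = 0) \/
  exists p q, [/\ p \in L, q \in L, 0 < coefficient k p.2,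
    coefficient k q.2 < 0 & c = cancel_coefficient k p q].
Proof.
rewrite mem_cat mem_filter => /orP[/andP[/eqP c0 cL]|]; first by left.
case/allpairsP=> -[p q] /= []; rewrite !mem_filter => /andP[p0 pL] /andP[q0 qL] ->.
by right; exists p, q.
Qed.

Lemma eliminate_consequence k L c : c \in eliminate k L -> consequence L c.1 c.2.
Proof.
case/eliminateP=> [[cL _]|[p [q [pL qL p0 q0 ->]]]]; first exact: conseq_mem.
apply: conseq_add; apply: consequenceMn; try exact: conseq_mem.
  by rewrite absz_gt0 ltr0_neq0.
by rewrite absz_gt0 lt0r_neq0.
Qed.

Lemma eliminate_coefficient j k L :
  (forall c, c \in L -> j != k -> coefficient j c.2 = 0) ->
  forall c, c \in eliminate k L -> coefficient j c.2 = 0.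
Proof.
move=> Lj c /eliminateP[[cL c0]|[p [q [pL qL p0 q0 ->]]]].
  by have [->//|jk] := eqVneq j k; exact: Lj.
rewrite coefficientD !coefficientMn; have [->|jk] := eqVneq j k; last first.
  by rewrite !Lj // !mul0rn.
rewrite -(mulr_natr (coefficient k p.2)) -(mulr_natr (coefficient k q.2)) !natz.
by rewrite !abszE ltr0_norm // gtr0_norm // mulrN mulrC addNr.
Qed.

Hypothesis divD : forall (d : D) (m : nat), (0 < m)%N -> exists e, e *+ m = d.
Hypothesis ntD : exists e : D, 0 < e.

(** Only the k-th coordinate of x has to change: the inequalities of L bound
    the increment t from both sides, and those of [eliminate k L] say that the
    bounds are compatible. *)
Lemma eliminate_satisfiable k L x : all (satisfies x) (eliminate k L) ->
  exists y, all (satisfies y) L.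
Proof.
move=> xL.
have div_fun : exists quo : D -> nat -> D,
    forall e m, (0 < m)%N -> quo e m *+ m = e.
  have ex_quo (e : D) m : exists q : D, q *+ m.+1 == e.
    by have [q <-] := divD e (ltn0Sn m); exists q.
  exists (fun e m => xchoose (ex_quo e m.-1)) => e [//|m] _.
  exact/eqP/(xchooseP (ex_quo e m)).
have [quo quoK] := div_fun.
pose ev c := affine_eval iota c.2 x; pose a c := `|coefficient k c.2|%N.
pose A := [seq (c.1, quo (- ev c) (a c)) | c <- L & 0 < coefficient k c.2].
pose B := [seq (c.1, quo (ev c) (a c)) | c <- L & coefficient k c.2 < 0].
have a_gt0 c : coefficient k c.2 != 0 -> (0 < a c)%N by rewrite absz_gt0.
(* A and B are the lower and the upper bounds on the increment t. *)
have [|t [tA tB]] := @separation D divD ntD A B.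
  move=> _ _ /mapP[p + ->] /mapP[q + ->] /=.
  rewrite !mem_filter => /andP[p0 pL] /andP[q0 qL].
  have ap := a_gt0 _ (lt0r_neq0 p0); have aq := a_gt0 _ (ltr0_neq0 q0).
  (* Clearing denominators turns compatibility into the combined inequality. *)
  rewrite -(oz_lteifMn2r _ _ _ ap) -(oz_lteifMn2r _ _ _ aq) quoK // mulrnAC.
  rewrite quoK // mulNrn -oz_lteif0D.
  have /(allP xL) : cancel_coefficient k p q \in eliminate k L.
    by rewrite mem_cat allpairs_f ?orbT // mem_filter ?p0 ?q0.
  by rewrite /satisfies affine_evalD !affine_evalMn.
exists (\row_j (x ord0 j + t *+ (j == k))); apply/allP => c cL.
rewrite /satisfies affine_eval_shift.
have [c0|c0|c0] := ltrgt0P (coefficient k c.2).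
- have ac := a_gt0 _ (lt0r_neq0 c0).
  have := tA (c.1, quo (- ev c) (a c)); rewrite map_f ?mem_filter ?c0 // => /(_ isT).
  rewrite /= -(oz_lteifMn2r _ _ _ ac) quoK // oz_lteif0D.
  by have -> : coefficient k c.2 = a c by rewrite /a abszE gtr0_norm.
- have ac := a_gt0 _ (ltr0_neq0 c0).
  have := tB (c.1, quo (ev c) (a c)); rewrite map_f ?mem_filter ?c0 // => /(_ isT).
  rewrite /= -(oz_lteifMn2r _ _ _ ac) quoK // oz_lteif0D.
  have -> : coefficient k c.2 = - (a c : int) by rewrite /a abszE ltr0_norm ?opprK.
  by rewrite mulrNz oz_lteifN.
- rewrite c0 mulr0z addr0; apply: (allP xL).
  by rewrite mem_cat mem_filter c0 eqxx cL.
Qed.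

Hypothesis monoI : {mono iota : h k / h <= k}.

(** The sequence vs lists the variables that may still occur.  When it is
    empty, a constraint that fails at the origin is a false inequality between
    constants, over D and hence over H. *)
Lemma fourier_motzkin (vs : seq 'I_n) L :
  (forall j, j \notin vs -> forall c, c \in L -> coefficient j c.2 = 0) ->
  (forall x, ~~ all (satisfies x) L) ->
  exists w h, consequence L w (affine_const n h) /\ ~~ (0 < h ?<= if w).
Proof.
elim: vs L => [|k vs IH] L Lvs unsat.
  have /allPn[c cL cN] := unsat 0.
  have cE := coefficient0P (fun j => Lvs j isT c cL).
  exists c.1, c.2.1; split; first by rewrite -cE; exact: conseq_mem.
  move: cN; rewrite /satisfies cE affine_eval_const -(raddf0 iota).
  by case: (c.1); rewrite /= ?oz_ltNge monoI.
have [|x|w [h [Lh hN]]] := IH (eliminate k L).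
- move=> j jvs; apply: eliminate_coefficient => c cL jk.
  by apply: Lvs cL; rewrite inE negb_or jk.
- by apply/negP => /eliminate_satisfiable[y]; apply/negP.
exists w, h; split=> //; apply: consequence_trans Lh.
exact: eliminate_consequence.
Qed.

End FourierMotzkin.

(** * From a contradiction to an identity *)

Section Certificate.
Variables (H : orderedZmodType) (n : nat) (Req0 Rge0 Rgt0 : seq (affine_form H n)).
Implicit Types (f s q i : affine_form H n) (w : bool).

Let P := generated_submonoid
  (fun f => [\/ f \in Rge0, f \in Rgt0 | positive_const f]).
Let G := generated_subgroup (fun f => f \in Req0).
Let strict s := s \in Rgt0 \/ positive_const s.

Definition sign_constraints : seq (bool * affine_form H n) :=
  [seq (false, u) | u <- Rgt0] ++ [seq (true, q) | q <- Rge0] ++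
  [seq (true, j) | j <- Req0] ++ [seq (true, - j) | j <- Req0].

(** Only one strict term can be singled out; the strict terms of further
    summands go into the monoid P, which contains them. *)
Lemma consequence_decomposition w f : consequence sign_constraints w f ->
  exists s q i, [/\ if w then s = 0 else strict s, P q, G i & f = s + q + i].
Proof.
have sP s : strict s -> P s.
  by case=> sR; apply: gen_monoid_mem; [exact: Or32 | exact: Or33].
elim=> [c|{}w {}f w' f' _ [s [q [i [sw Pq Gi ->]]]]
             _ [s' [q' [i' [sw' Pq' Gi' ->]]]]].
  rewrite !mem_cat => /or4P[] /mapP[r rR ->] /=.
  - exists r, 0, 0; rewrite !addr0; split=> //; first by left.
      exact: gen_monoid0.
    exact: gen_group0.
  - exists 0, r, 0; rewrite add0r addr0; split=> //; last exact: gen_group0.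
    by apply: gen_monoid_mem; exact: Or31.
  - exists 0, 0, r; rewrite !add0r; split=> //; first exact: gen_monoid0.
    exact: gen_group_mem.
  - exists 0, 0, (- r); rewrite !add0r; split=> //; first exact: gen_monoid0.
    by apply: gen_groupN; exact: gen_group_mem.
have Gii' : G (i + i') by exact: gen_groupD.
have Pqq' : P (q + q') by exact: gen_monoidD.
rewrite addrACA (addrACA s).
case: w sw => [->|sw].
  by exists s', (q + q'), (i + i'); rewrite add0r; split.
case: w' sw' => [->|sw'].
  by exists s, (q + q'), (i + i'); rewrite addr0; split.
exists s, (s' + (q + q')), (i + i'); rewrite !addrA; split=> //.
by rewrite -addrA; apply: gen_monoidD => //; exact: sP.
Qed.

(** The positive constant - h, when h < 0, compensates the constant h. *)
Lemma contradiction_certificate w (h : H) :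
  consequence sign_constraints w (affine_const n h) -> ~~ (0 < h ?<= if w) ->
  exists s q i, [/\ strict s, P q, G i & s + q + i = 0].
Proof.
move=> /consequence_decomposition[s [q [i [sw Pq Gi def_h]]]] hN.
have negh : h < 0 -> positive_const (affine_const n (- h)).
  by move=> h0; exists (- h); rewrite ?oz_oppr_gt0.
have hK : affine_const n (- h) + affine_const n h = 0.
  by congr (_, _); rewrite /= ?addNr ?addr0.
case: w sw hN => [s0|sw]; rewrite /= -?oz_ltNge.
  move/negh => h_lt0; exists (affine_const n (- h)), q, i; split=> //.
    by right.
  by rewrite -[RHS]hK def_h s0 add0r addrA.
rewrite oz_ltNge negbK le_eqVlt => /predU1P[h0|/negh h_lt0].
  by exists s, q, i; split=> //; rewrite -def_h h0.
exists s, (q + affine_const n (- h)), i; split=> //.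
  by apply: gen_monoidD => //; apply: gen_monoid_mem; exact: Or33.
by rewrite (addrA s) (addrC (s + q)) -addrA -def_h.
Qed.

End Certificate.

(* H is nontrivial: for H = 0 and n = 1, the system x_1 > 0 is impossible in
   D = 0, but no positive multiple of x_1 is the zero form. *)
Theorem theorem5p7 (H D : orderedZmodType) (ntH : exists h : H, h != 0)
    (iota : {additive H -> D})
    (closD : is_divisible_ordered_closure iota) (n : nat)
    (Req0 Rge0 Rgt0 : seq (affine_form H n)) :
  (~ exists x : 'rV[D]_n,
      [/\ forall u, u \in Rgt0 -> 0 < affine_eval iota u x,
          forall q, q \in Rge0 -> 0 <= affine_eval iota q x
        & forall j, j \in Req0 -> affine_eval iota j x = 0])
  <->
  (exists s q i : affine_form H n,
      [/\ s \in Rgt0 \/ positive_const s,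
          generated_submonoid
            (fun f => [\/ f \in Rge0, f \in Rgt0 | positive_const f]) q,
          generated_subgroup (fun f => f \in Req0) i
        & s + q + i = 0]).
Proof.
have ntD : exists e : D, 0 < e.
  have [h h0] := oz_gt0_exists ntH; exists (iota h).
  by move: h0; rewrite !oz_ltNge -(raddf0 iota) (closure_mono closD).
split=> [unsat|[s [q [i [sR Pq Gi sqi]]]] [x [gt0 ge0 eq0]]].
  have [||w [h [Lh hN]]] := @fourier_motzkin H D iota n (closure_divisible closD) ntD
    (closure_mono closD) (enum 'I_n) (sign_constraints Req0 Rge0 Rgt0).
  - by move=> j; rewrite mem_enum.
  - move=> x; apply/negP => /allP xL; apply: unsat; exists x.
    split=> [u uR|q qR|j jR].
    + by have /xL : (false, u) \in sign_constraints Req0 Rge0 Rgt0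
        by rewrite mem_cat (map_f (pair false)).
    + by have /xL : (true, q) \in sign_constraints Req0 Rge0 Rgt0
        by rewrite !mem_cat (map_f (pair true)) ?orbT.
    + have /xL j_ge0 : (true, j) \in sign_constraints Req0 Rge0 Rgt0
        by rewrite !mem_cat orbCA (map_f (pair true) jR) !orbT.
      have /xL j_le0 : (true, - j) \in sign_constraints Req0 Rge0 Rgt0
        by rewrite !mem_cat (map_f (fun j => (true, - j)) jR) !orbT.
      apply/eqP; rewrite eq_le -oz_oppr_ge0 -affine_evalN.
      exact/andP.
  exact: contradiction_certificate Lh hN.
have const_gt0 f : positive_const f -> 0 < affine_eval iota f x.
  case=> h h0 ->; rewrite affine_eval_const.
  by move: h0; rewrite !oz_ltNge -(raddf0 iota) (closure_mono closD).
have s_gt0 : 0 < affine_eval iota s x by case: sR => [/gt0|/const_gt0].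
have q_ge0 : 0 <= affine_eval iota q x.
  elim: Pq => [f [/ge0|/gt0/ltW|/const_gt0/ltW]//||f g _ f0 _ g0].
    by rewrite affine_eval0.
  by rewrite affine_evalD -[0]addr0 oz_lerD.
have i_eq0 : affine_eval iota i x = 0.
  elim: Gi => [f /eq0//||f g _ f0 _ g0|f _ f0]; first exact: affine_eval0.
    by rewrite affine_evalD f0 g0 addr0.
  by rewrite affine_evalN f0 oppr0.
have : 0 < affine_eval iota (s + q + i) x.
  by rewrite !affine_evalD i_eq0 addr0 -[ltLHS]addr0 oz_ltrD.
by rewrite sqi affine_eval0 ltxx.
Qed.
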